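(* Let $B$ be a Banach SSD space (Simons space) and $A\subseteq B$ a maximally $q$-positive set. Then $\overline{E_A}\in\mathbb{E}_{ca}(A)$, where $E_A:\mathbb{R}_+\rightrightarrows B$ is given by $E_A(\varepsilon)=\bigcap_{E\in\mathbb{E}(A)}E(\varepsilon)$ for all $\varepsilon\geq 0$.
   Context: A symmetrically self-dual space (SSD space) is a pair $(B,\lfloor\cdot,\cdot\rfloor)$ where $B$ is a nonzero real vector space and $\lfloor\cdot,\cdot\rfloor:B\times B\to\mathbb{R}$ is a symmetric bilinear form. Put $q:B\to\mathbb{R}$, $q(b)=\frac12\lfloor b,b\rfloor$. $B$ is a Banach SSD space (Simons space) if it is an SSD space with a norm $\|\cdot\|$ making it a Banach space with norm-dual $B^*$, such that $\frac12\|\cdot\|^2+q\geq 0$ on $B$ and there exists a linear continuous map $\iota:B\to B^*$ with $\langle b,\iota(c)\rangle=\lfloor b,c\rfloor$ for all $b,c\in B$. A set $A\subseteq B$ is $q$-positive if $A\neq\emptyset$ and $q(b-c)\geq 0$ for all $b,c\in A$; it is maximally $q$-positive if it is $q$-positive and maximal with respect to inclusion among the $q$-positive subsets of $B$. $\mathbb{R}_+=[0,+\infty)$. The graph of $E:\mathbb{R}_+\rightrightarrows B$ is $G(E)=\{(\varepsilon,b)\in\mathbb{R}_+\times B: b\in E(\varepsilon)\}$, and $\overline{E}:\mathbb{R}_+\rightrightarrows B$ is defined by $\overline{E}(\varepsilon)=\{b\in B:(\varepsilon,b)\in\overline{G(E)}\}$ (closure in the norm topology); $E$ is closed if $E=\overline{E}$.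 A multifunction $E:\mathbb{R}_+\rightrightarrows B$ satisfies the transportation formula if for all $\varepsilon_1,\varepsilon_2\geq 0$, $b^1\in E(\varepsilon_1)$, $b^2\in E(\varepsilon_2)$ and all $\alpha_1,\alpha_2\geq 0$ with $\alpha_1+\alpha_2=1$ one has $\varepsilon:=\alpha_1\varepsilon_1+\alpha_2\varepsilon_2+\alpha_1\alpha_2 q(b^1-b^2)\geq 0$ and $\alpha_1b^1+\alpha_2b^2\in E(\varepsilon)$. $\mathbb{E}(A)$ is the family of multifunctions $E:\mathbb{R}_+\rightrightarrows B$ such that: (r1) $A\subseteq E(\varepsilon)$ for all $\varepsilon\geq 0$; (r2) $0\leq\varepsilon_1\leq\varepsilon_2$ implies $E(\varepsilon_1)\subseteq E(\varepsilon_2)$; (r3) $E$ satisfies the transportation formula. $\mathbb{E}_c(A)=\{E\in\mathbb{E}(A):E\text{ is closed}\}$. A multifunction $E:\mathbb{R}_+\rightrightarrows B$ is additive if for all $\varepsilon_1,\varepsilon_2\geq 0$ and $b^1\in E(\varepsilon_1)$, $b^2\in E(\varepsilon_2)$ one has $q(b^1-b^2)\geq-(\varepsilon_1+\varepsilon_2)$. $\mathbb{E}_{ca}(A)=\{E\in\mathbb{E}_c(A):E\text{ is additive}\}$. *)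

(* Defs.v *)
From HB Require Import structures.
From mathcomp Require Import all_boot all_order all_algebra.
From mathcomp Require Import interval_inference sesquilinear.
From mathcomp Require Import all_classical all_reals all_analysis.

Set Implicit Arguments.
Unset Strict Implicit.
Unset Printing Implicit Defensive.

Import Order.TTheory GRing.Theory Num.Theory.
Import numFieldNormedType.Exports.

Local Open Scope classical_set_scope.
Local Open Scope ring_scope.

Section dual_space.
Context {R : realType} {B : normedModType R}.

Definition dual_pred : {pred B -> R^o} :=
  mem [set f : B -> R^o | linear f /\ continuous f].

Fact dual_submod_closed : submod_closed dual_pred.
Proof.
split=> [|a f g]; first by rewrite inE; split=> [k x y|x] /=;
  [rewrite scaler0 addr0|exact: cvg_cst].
rewrite !inE => -[fl fc] [gl gc]; split.
  move=> k x y; have := fl k x y; have := gl k x y => /= glk flk.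
  rewrite !fctE glk flk !scalerDr !scalerA mulrC -!addrA.
  by congr (_ + _); rewrite addrCA.
by move=> x; apply: cvgD; [apply: cvgZl_tmp; exact: fc|exact: gc].
Qed.

HB.instance Definition _ :=
  GRing.isSubmodClosed.Build R (B -> R^o) dual_pred dual_submod_closed.

End dual_space.

(* Continuous linear functionals on B; made below into a normed module whose norm
   is the operator norm dual_norm. *)
Record dual (R : realType) (B : normedModType R) := Dual {
  dual_fun :> B -> R^o;
  _ : dual_fun \in dual_pred }.

Section dual_normed.
Context {R : realType} {B : normedModType R}.

HB.instance Definition _ := [isSub for @dual_fun R B].
HB.instance Definition _ := [Choice of dual B by <:].
HB.instance Definition _ := [SubChoice_isSubLmodule of dual B by <:].

Definition dual_norm (f : dual B) : R :=
  sup [set `|f x| | x in [set x : B | `|x| <= 1]].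

Lemma dual_linear (f : dual B) : linear f.
Proof. by case: f => f /=; rewrite inE => -[]. Qed.

HB.instance Definition _ (f : dual B) :=
  GRing.isLinear.Build R B R^o *:%R f (dual_linear f).

Lemma dual_continuous (f : dual B) : continuous f.
Proof. by case: f => f /=; rewrite inE => -[]. Qed.

Lemma dual_has_sup (f : dual B) :
  has_sup [set `|f x| | x in [set x : B | `|x| <= 1]].
Proof.
split; first by exists `|f 0|, 0; rewrite //= normr0.
have /linear_bounded_continuous/bounded_funP/(_ 1)[M hM] := @dual_continuous f.
by exists M => _ [x /= x1 <-]; exact: hM.
Qed.

Lemma dual_norm_ub (f : dual B) x : `|x| <= 1 -> `|f x| <= dual_norm f.
Proof.
by move=> x1; apply: ub_le_sup; [exact: (dual_has_sup f).2|exists x].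
Qed.

Lemma dual_norm_le (f : dual B) (M : R) :
  (forall x, `|x| <= 1 -> `|f x| <= M) -> dual_norm f <= M.
Proof.
by move=> fM; apply: ge_sup; [exact: (dual_has_sup f).1|move=> _ [x x1 <-]; exact: fM].
Qed.

Fact dual_ler_normD (f g : dual B) :
  dual_norm (f + g) <= dual_norm f + dual_norm g.
Proof.
apply: dual_norm_le => x x1.
by rewrite (le_trans (ler_normD _ _))// lerD// dual_norm_ub.
Qed.

Fact dual_normrZ (l : R) (f : dual B) : dual_norm (l *: f) = `|l| * dual_norm f.
Proof.
have le (k : R) (g : dual B) : dual_norm (k *: g) <= `|k| * dual_norm g.
  by apply: dual_norm_le => x x1; rewrite normrM ler_wpM2l// dual_norm_ub.
apply/eqP; rewrite eq_le le /=; have [->|l0] := eqVneq l 0.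
  by rewrite normr0 mul0r (le_trans _ (@dual_norm_ub _ 0 _))// normr0.
rewrite -ler_pdivlMl ?normr_gt0// -normfV.
by rewrite -{1}(scalerK l0 f) le.
Qed.

Fact dual_norm0_eq0 (f : dual B) : dual_norm f = 0 -> f = 0.
Proof.
move=> f0; apply/val_inj/funext => x /=; apply/eqP.
have [->|x0] := eqVneq x 0; first by rewrite linear0.
have /dual_norm_ub : `| `|x|^-1 *: x| <= 1.
  by rewrite normrZ normfV normr_id mulVf ?normr_eq0.
move=> /(_ f); rewrite f0 normr_le0 linearZ /= scaler_eq0 invr_eq0 normr_eq0.
by rewrite (negPf x0).
Qed.

HB.instance Definition _ := Lmodule_isNormed.Build R (dual B)
  dual_ler_normD dual_normrZ dual_norm0_eq0.

End dual_normed.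

Section ssd.
Context {R : realType} {B : completeNormedModType R} (form : {symmetric B}).

Definition q (b : B) : R := form b b / 2.

Record banach_ssd : Prop := {
  banach_ssd_nontrivial : exists b : B, b != 0;
  banach_ssd_norm_q : forall b : B, 0 <= `|b| ^+ 2 / 2 + q b;
  banach_ssd_iota : exists iota : {linear B -> dual B},
    continuous iota /\ forall b c : B, iota c b = form b c }.

Definition q_positive (A : set B) : Prop :=
  A !=set0 /\ forall b c, A b -> A c -> 0 <= q (b - c).

Definition maximally_q_positive (A : set B) : Prop :=
  q_positive A /\ forall A', q_positive A' -> A `<=` A' -> A' = A.

Definition multifunction : Type := {nonneg R} -> set B.

Implicit Type E : multifunction.

Definition mgraph E : set (R * B) :=
  [set p | exists2 e : {nonneg R}, p.1 = e%:num & E e p.2].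

(* R_+ x B is closed in R x B, so closing the graph in R x B is the same as
   closing it in R_+ x B. *)
Definition mclosure E : multifunction :=
  fun e => [set b | closure (mgraph E) (e%:num, b)].

Definition mclosed E : Prop := E = mclosure E.

(* The witness e_ge0 makes the claim eps >= 0 explicit: E only accepts
   nonnegative arguments. *)
Definition transportation E : Prop :=
  forall (e1 e2 : {nonneg R}) (b1 b2 : B), E e1 b1 -> E e2 b2 ->
  forall a1 a2 : R, 0 <= a1 -> 0 <= a2 -> a1 + a2 = 1 ->
  exists e_ge0 : 0 <= a1 * e1%:num + a2 * e2%:num + a1 * a2 * q (b1 - b2),
    E (NngNum e_ge0) (a1 *: b1 + a2 *: b2).

Definition madditive E : Prop :=
  forall (e1 e2 : {nonneg R}) (b1 b2 : B), E e1 b1 -> E e2 b2 ->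
  - (e1%:num + e2%:num) <= q (b1 - b2).

Definition enlargements (A : set B) : set multifunction :=
  [set E | [/\ forall e, A `<=` E e,
               forall e1 e2 : {nonneg R}, e1%:num <= e2%:num -> E e1 `<=` E e2
             & transportation E]].

Definition enlargements_c (A : set B) : set multifunction :=
  [set E | enlargements A E /\ mclosed E].

Definition enlargements_ca (A : set B) : set multifunction :=
  [set E | enlargements_c A E /\ madditive E].

Definition smallest_enlargement (A : set B) : multifunction :=
  fun e => \bigcap_(E in enlargements A) E e.

End ssd.

(* Main.v *)
Require Import Defs.
From mathcomp Require Import all_boot all_order all_algebra.
From mathcomp Require Import sesquilinear.
From mathcomp Require Import all_classical all_reals all_analysis.
From mathcomp Require Import interval_inference ring lra.

Set Implicit Arguments.
Unset Strict Implicit.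
Unset Printing Implicit Defensive.

(** The trick is that one inequality is stable under convex combinations exactly
    up to the error allowed by the transportation formula. Since q is quadratic,
      q (a1 b1 + a2 b2 - c) = a1 q (b1 - c) + a2 q (b2 - c) - a1 a2 q (b1 - b2)
    whenever a1 + a2 = 1 ([q_convex_comb]), so for a fixed pair (e0, c) the set of
    the pairs (e, b) with q (b - c) >= - (e + e0) is closed under transportation.

    With e0 = 0 and c ranging over A, these conditions cut out the largest
    enlargement of A. Maximality of A is used to see that transportation keeps the
    error e nonnegative: if e < 0, the transported point b satisfies
    q (b - a) >= - e > 0 for all a in A, hence lies in A by maximality, and a = b
    gives a contradiction. An intersection of enlargements can leave the half-line
    of nonnegative errors only if all of them do, so the smallest enlargement E_A,
    too, is an enlargement.

    Additivity of E_A: for (e0, c) in its graph, c belongs to the value at e0 of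
    the largest enlargement, which says that every point of A satisfies the
    condition of (e0, c) with e = 0. Hence imposing this condition on E_A
    leaves an enlargement ([trim_enlargement]), which by minimality contains E_A.

    Finally q is continuous, because iota is bounded, and the transportation map
    (e1, b1), (e2, b2) |-> (e, b) is then continuous. Monotonicity, transportation
    and additivity say that continuous maps send the graph, or its square, into
    the graph or into a closed half-line, and this survives taking closures. *)

Import Order.TTheory GRing.Theory Num.Theory.
Import numFieldNormedType.Exports.

Local Open Scope classical_set_scope.
Local Open Scope ring_scope.

(** * Continuous maps and closures *)

Section closure_image.

Lemma closure_image (X Y : topologicalType) (f : X -> Y)
    (C : set X) (D : set Y) x :
  {for x, continuous f} -> (forall u, C u -> D (f u)) ->
  closure C x -> closure D (f x).
Proof.
move=> fc CD Cx V /fc fV; have [u [Cu Vu]] := Cx _ fV.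
by exists (f u); split => //; exact: CD.
Qed.

Lemma closed_image (X Y : topologicalType) (f : X -> Y)
    (C : set X) (D : set Y) x : closed D ->
  {for x, continuous f} -> (forall u, C u -> D (f u)) ->
  closure C x -> D (f x).
Proof. by move=> /closure_id {2}-> fc CD; exact: closure_image. Qed.

Lemma closure_setX (X Y : topologicalType) (C : set X) (D : set Y) x y :
  closure C x -> closure D y -> closure (C `*` D) (x, y).
Proof.
move=> Cx Dy V [[U W] /= [Ux Wy] UWV].
have [u [Cu Uu]] := Cx _ Ux; have [v [Dv Wv]] := Dy _ Wy.
by exists (u, v); split => //; exact: (UWV (u, v)).
Qed.

Lemma continuous_pair (X Y Z : topologicalType) (f : X -> Y) (g : X -> Z) x :
  {for x, continuous f} -> {for x, continuous g} ->
  {for x, continuous (fun u => (f u, g u))}.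
Proof. by move=> fc gc; exact: cvg_pair. Qed.

End closure_image.

(** * The quadratic form of a Banach SSD space *)

Section quadratic.
Context {R : realType} {B : completeNormedModType R} (form : {symmetric B}).

Local Notation q := (q form).

Lemma q0 : q 0 = 0.
Proof. by rewrite /Defs.q linear0l mul0r. Qed.

Lemma formC x y : form x y = form y x.
Proof. by rewrite hermC expr0 mul1r. Qed.

Lemma formDl x y z : form (x + y) z = form x z + form y z.
Proof. by rewrite linearDl. Qed.

Lemma formZl a x y : form (a *: x) y = a * form x y.
Proof. by rewrite linearZl_LR. Qed.

Lemma formZr a x y : form x (a *: y) = a * form x y.
Proof. by rewrite linearZr_LR. Qed.

Lemma qN x : q (- x) = q x.
Proof. by rewrite /Defs.q linearNl linearNr opprK. Qed.

Lemma qB x y : q (x - y) = q x + q y - form x y.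
Proof.
by rewrite /Defs.q linearBl !linearBr /= (formC y x); field.
Qed.

Lemma qD x y : q (x + y) = q x + q y + form x y.
Proof. by rewrite -[y in LHS]opprK qB qN linearNr opprK. Qed.

Lemma qZ a x : q (a *: x) = a ^+ 2 * q x.
Proof. by rewrite /Defs.q formZl formZr mulrA mulrA. Qed.

(** The Stewart-type identity that matches the error of the transportation
    formula. *)
Lemma q_convex_comb (a1 a2 : R) (b1 b2 c : B) : a1 + a2 = 1 ->
  q (a1 *: b1 + a2 *: b2 - c) =
  a1 * q (b1 - c) + a2 * q (b2 - c) - a1 * a2 * q (b1 - b2).
Proof.
move=> a12; have -> : a2 = 1 - a1 by rewrite -a12 addrC addKr.
rewrite !qB qD !qZ formDl !formZl formZr.
by ring.
Qed.

(** The operator norm of iota bounds the form: rescale x to the unit ball for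
    the functional iota y, then use that iota itself is bounded. *)
Lemma form_bounded (ssd : banach_ssd form) :
  exists K, forall x y, `|form x y| <= K * `|x| * `|y|.
Proof.
have [iota [iota_cont iotaE]] := banach_ssd_iota ssd.
have /linear_bounded_continuous/linear_boundedP[K [_ Kb]] := iota_cont.
exists (K + 1) => x y; rewrite -iotaE.
have [->|x0] := eqVneq x 0.
  by rewrite linear0 !normr0 mulr0 mul0r.
have nx : 0 < `|x| by rewrite normr_gt0.
have : `|iota y (`|x|^-1 *: x)| <= `|iota y|.
  by apply: dual_norm_ub; rewrite normrZ normfV normr_id mulVf ?gt_eqF.
rewrite linearZ normrZ normfV normr_id ler_pdivrMl// => /le_trans; apply.
rewrite mulrAC mulrC ler_pM2r//; apply: Kb; lra.
Qed.

Lemma q_continuous : banach_ssd form -> continuous q.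
Proof.
move=> /form_bounded[K formK] x.
have dq y : `|q y - q x| <= K / 2 * (`|y - x| * `|y + x|).
  (* difference of two squares for a symmetric form *)
  have -> : q y - q x = form (y - x) (y + x) / 2.
    by rewrite /Defs.q linearBl !linearDr /= (formC y x); field.
  by rewrite normrM [`|2^-1|]ger0_norm// mulrAC ler_pM2r// mulrA formK.
have d0 : K / 2 * (`|y - x| * `|y + x|) @[y --> x] --> (0 : R).
  rewrite -[X in _ --> X](mulr0 (K / 2)); apply: cvgM; first exact: cvg_cst.
  rewrite -[X in _ --> X](mul0r `|x + x|); apply: cvgM; last first.
    by apply: cvg_norm; apply: cvgD; [exact: cvg_id|exact: cvg_cst].
  rewrite -[X in _ --> X](@normr0 _ B); apply: cvg_norm.
  by apply/subr_cvg0; exact: cvg_id.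
apply/subr_cvg0; apply: norm_cvg0.
apply: (squeeze_cvgr _ _ d0); last exact: cvg_cst.
by near=> y; rewrite normr_ge0 dq.
Unshelve. all: by end_near.
Qed.

(** * The largest and the smallest enlargement *)

Definition largest_enlargement (A : set B) : multifunction :=
  fun e => [set b | forall a, A a -> - e%:num <= q (b - a)].

(** Adding such a b to A keeps it q-positive. *)
Lemma maximally_q_positive_mem (A : set B) b : maximally_q_positive form A ->
  (forall a, A a -> 0 <= q (b - a)) -> A b.
Proof.
move=> [[A0 Aq] Amax] bA; rewrite -(Amax (A `|` [set b])) ?[_ b]/=; [|split|].
- by right.
- by case: A0 => a Aa; exists a; left.
- move=> c d [Ac|->] [Ad|->]; [exact: Aq| |exact: bA|].
  + by rewrite -qN opprB bA.
  + by rewrite subrr q0.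
- by move=> a; left.
Qed.

(** Without the maximality of A, a transported error could be negative. *)
Lemma largest_enlargementP (A : set B) : maximally_q_positive form A ->
  enlargements form A (largest_enlargement A).
Proof.
move=> Amax; have [[_ Aq] _] := Amax.
split=> [e b Ab a Aa|e1 e2 e12 b Eb a Aa|].
- by rewrite (le_trans _ (Aq _ _ Ab Aa))// oppr_le0.
- by rewrite (le_trans _ (Eb _ Aa))// lerN2.
move=> e1 e2 b1 b2 E1 E2 a1 a2 a1_ge0 a2_ge0 a12.
set e := _ + _ + _; set b := _ + _.
have eb a : A a -> - e <= q (b - a).
  move=> Aa; rewrite q_convex_comb// /e.
  have := ler_wpM2l a1_ge0 (E1 _ Aa); have := ler_wpM2l a2_ge0 (E2 _ Aa).
  lra.
have e_ge0 : 0 <= e.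
  rewrite leNgt; apply/negP => e_lt0.
  have Ab : A b.
    by apply: (maximally_q_positive_mem Amax) => a Aa; have := eb _ Aa; lra.
  by have := eb _ Ab; rewrite subrr q0; lra.
by exists e_ge0.
Qed.

(** Membership of the largest enlargement in the family provides the
    nonnegativity of the transported error, which an intersection over an empty
    family would lack. *)
Lemma smallest_enlargementP (A : set B) : maximally_q_positive form A ->
  enlargements form A (smallest_enlargement form A).
Proof.
move=> Amax; split=> [e b Ab E [EA _ _]|e1 e2 e12 b Eb E EE|].
- exact: EA.
- by have [_ mono _] := EE; apply: mono e12 _ (Eb _ EE).
move=> e1 e2 b1 b2 E1 E2 a1 a2 a1_ge0 a2_ge0 a12.
have LE := largest_enlargementP Amax; have [_ _ LT] := LE.
have [e_ge0 _] := LT _ _ _ _ (E1 _ LE) (E2 _ LE) _ _ a1_ge0 a2_ge0 a12.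
exists e_ge0 => E EE; have [_ _ ET] := EE.
have [e_ge0' Eb] := ET _ _ _ _ (E1 _ EE) (E2 _ EE) _ _ a1_ge0 a2_ge0 a12.
by rewrite (bool_irrelevance e_ge0 e_ge0').
Qed.

(** Additivity imposed against one graph point (e0, c) at a time, since the
    condition is then preserved by transportation. *)
Definition trim (E : @multifunction R B) (e0 : {nonneg R}) (c : B) : multifunction :=
  fun e => [set b | E e b /\ - (e%:num + e0%:num) <= q (b - c)].

(** By [q_convex_comb], the inequality against c passes to transported pairs, e0
    being averaged with itself; the hypothesis on c says that A survives the
    trimming. *)
Lemma trim_enlargement (A : set B) E (e0 : {nonneg R}) c :
  enlargements form A E -> largest_enlargement A e0 c ->
  enlargements form A (trim E e0 c).
Proof.
move=> [EA mono ET] Lc; split=> [e b Ab|e1 e2 e12 b [Eb bc]|].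
- split; first exact: EA.
  by rewrite -qN opprB (le_trans _ (Lc _ Ab))// lerN2 lerDr.
- by split; [exact: mono e12 _ Eb|rewrite (le_trans _ bc)// lerN2 lerD2r].
move=> e1 e2 b1 b2 [E1 q1] [E2 q2] a1 a2 a1_ge0 a2_ge0 a12.
have [e_ge0 Eb] := ET _ _ _ _ E1 E2 _ _ a1_ge0 a2_ge0 a12.
exists e_ge0; split=> //=; rewrite q_convex_comb//.
have := ler_wpM2l a1_ge0 q1; have := ler_wpM2l a2_ge0 q2.
have -> : a2 = 1 - a1 by rewrite -a12 addrC addKr.
lra.
Qed.

(** Trimming the smallest enlargement by a point of its own graph cannot make
    it smaller. *)
Lemma smallest_enlargement_additive (A : set B) : maximally_q_positive form A ->
  madditive form (smallest_enlargement form A).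
Proof.
move=> Amax e1 e2 b1 b2 E1 E2.
have T1 := trim_enlargement (smallest_enlargementP Amax)
  (E2 _ (largest_enlargementP Amax)).
by have [] := E1 _ T1.
Qed.

(** * Closures of enlargements *)

(** The closure of a graph stays over the closed half-line of nonnegative
    errors, so every one of its points is seen by the closed multifunction. *)
Lemma mgraph_mclosure (E : @multifunction R B) :
  mgraph (mclosure E) = closure (mgraph E).
Proof.
apply/seteqP; split=> [[t b] [e /= -> //]|[t b] cl].
have t_ge0 : 0 <= t.
  apply: (closed_image (f := fst) (@closed_ge R 0) _ _ cl).
    exact: cvg_fst.
  by move=> _ [e -> _] /=.
by exists (NngNum t_ge0).
Qed.

Lemma mclosure_mclosed (E : @multifunction R B) : mclosed (mclosure E).
Proof.
apply/funext => e; rewrite [in RHS]/mclosure mgraph_mclosure.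
by rewrite -(iffLR (closure_id _) (@closed_closure _ _)).
Qed.

(** Covers both the transported error (a = a1 a2) and, with all three
    coefficients equal to 1, the additivity gap. *)
Lemma transport_continuous (a1 a2 a : R) : continuous q ->
  continuous (fun p : (R * B) * (R * B) =>
    a1 * p.1.1 + a2 * p.2.1 + a * q (p.1.2 - p.2.2)).
Proof.
move=> qc p; apply: cvgD; first apply: cvgD.
- apply: cvgM; first exact: cvg_cst.
  by apply: (@continuous_comp _ _ _ fst fst); exact: cvg_fst.
- apply: cvgM; first exact: cvg_cst.
  by apply: (@continuous_comp _ _ _ snd fst); [exact: cvg_snd|exact: cvg_fst].
- apply: cvgM; first exact: cvg_cst.
  apply: (@continuous_comp _ _ _ (fun p => p.1.2 - p.2.2) q) => [|]; last exact: qc.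
  apply: cvgB.
    by apply: (@continuous_comp _ _ _ fst snd); [exact: cvg_fst|exact: cvg_snd].
  by apply: (@continuous_comp _ _ _ snd snd); exact: cvg_snd.
Qed.

(** Monotonicity is invariance of the graph under the upward shifts of the
    error, and transportation is invariance under a continuous map on its square;
    both pass to the closure. *)
Lemma mclosure_enlargement (A : set B) E : continuous q ->
  enlargements form A E -> enlargements form A (mclosure E).
Proof.
move=> qc [EA mono ET]; split=> [e b Ab|e1 e2 e12 b cl|].
- by apply: subset_closure; exists e => //; exact: EA.
- set d : R := e2%:num - e1%:num; have d_ge0 : 0 <= d by rewrite subr_ge0.
  pose f (p : R * B) : R * B := (d + p.1, p.2).
  suff : closure (mgraph E) (f (e1%:num, b)) by rewrite /f /= subrK.
  apply: (closure_image _ _ cl).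
    apply: continuous_pair; last exact: cvg_snd.
    by apply: cvgD; [exact: cvg_cst|exact: cvg_fst].
  move=> [_ c] [e /= -> Ec].
  have e_ge0 : 0 <= d + e%:num by rewrite addr_ge0.
  by exists (NngNum e_ge0) => //; apply: mono Ec; rewrite /= lerDr.
move=> e1 e2 b1 b2 E1 E2 a1 a2 a1_ge0 a2_ge0 a12.
pose f (p : (R * B) * (R * B)) : R * B :=
  (a1 * p.1.1 + a2 * p.2.1 + a1 * a2 * q (p.1.2 - p.2.2),
   a1 *: p.1.2 + a2 *: p.2.2).
have : closure (mgraph E) (f ((e1%:num, b1), (e2%:num, b2))).
  apply: (closure_image _ _ (closure_setX E1 E2)).
    apply: continuous_pair; first exact: transport_continuous.
    apply: cvgD; apply: cvgZl_tmp.
    + by apply: (@continuous_comp _ _ _ fst snd); [exact: cvg_fst|exact: cvg_snd].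
    + by apply: (@continuous_comp _ _ _ snd snd); exact: cvg_snd.
  move=> [[_ c1] [_ c2]] [[d1 /= -> C1] [d2 /= -> C2]].
  have [e_ge0 Eb] := ET _ _ _ _ C1 C2 _ _ a1_ge0 a2_ge0 a12.
  by exists (NngNum e_ge0).
rewrite -mgraph_mclosure => -[e /= eE Eb].
have e_ge0 : 0 <= a1 * e1%:num + a2 * e2%:num + a1 * a2 * q (b1 - b2) by rewrite eE.
by exists e_ge0; rewrite /mclosure /= eE.
Qed.

Lemma mclosure_additive E : continuous q ->
  madditive form E -> madditive form (mclosure E).
Proof.
move=> qc Eadd e1 e2 b1 b2 E1 E2.
have /= := closed_image (@closed_ge R 0) (@transport_continuous 1 1 1 qc _) _
  (closure_setX E1 E2).
rewrite !mul1r -lerBlDl sub0r; apply.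
move=> [[_ c1] [_ c2]] [[d1 /= -> C1] [d2 /= -> C2]].
by rewrite !mul1r -lerBlDl sub0r; exact: Eadd.
Qed.

End quadratic.

Theorem proposition21 (R : realType) (B : completeNormedModType R)
    (form : {symmetric B}) (A : set B) :
  banach_ssd form -> maximally_q_positive form A ->
  enlargements_ca form A (mclosure (smallest_enlargement form A)).
Proof.
move=> /q_continuous qc Amax; split; first split.
- exact: mclosure_enlargement (smallest_enlargementP Amax).
- exact: mclosure_mclosed.
- exact: mclosure_additive (smallest_enlargement_additive Amax).
Qed.
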